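(* Let $G$ be a graph and $k$ be a positive integer. Then the following are equivalent: \begin{enumerate} \item The graph $G$ has chordality $k$. \item The minimum size of a non-edge-separating family of tree-decompositions of $G$ is $k$. \item $k$ is the minimum integer such that the graph $G$ is the intersection graph of a family of convex subgraphs of the Cartesian product of $k$ trees. \item $k$ is the minimum integer such that the graph $G$ is the intersection graph of a family of convex subgraphs of a median graph of tree-dimension $k$. \item The graph $G$ has tree-median-dimension $k$. \end{enumerate}
   Context: Graphs are finite, undirected, with no loops or parallel edges. A clique is a set of pairwise adjacent vertices. A non-edge of $G$ is a two-element subset of $V(G)$ that is not an edge. Chordality. A hole is an induced cycle of length at least four; a graph is chordal if it contains no holes. The intersection of graphs $G_1,\dots,G_k$ is the graph $(\bigcap_i V(G_i),\bigcap_i E(G_i))$. The chordality of $G$ is the minimum integer $k$ such that $G=G_1\cap\dots\cap G_k$ for some chordal graphs $G_1,\dots,G_k$ (equivalently, chordal graphs on the vertex set $V(G)$). Intersection graphs. The intersection graph of a finite family of nonempty sets has the members of the family as vertices, two (distinct) members being adjacent iff they have nonempty intersection. The intersection graph of a family of subgraphs is the intersection graph of the family of their vertex sets. ''$G$ is the intersection graph'' means up to isomorphism. Tree-decompositions. For a function $\beta:V(T)\to 2^{V(H)}$ and $v\in V(H)$, write $\beta^{-1}(v)=\{t\in V(T): v\in\beta(t)\}$. A representation of a chordal graph $H$ is a pair $(T,\beta)$ where $T$ is a tree and $\beta:V(T)\to 2^{V(H)}$ is such that for every $v\in V(H)$ the set $\beta^{-1}(v)$ is nonempty and induces a connected subgraph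 of $T$, and $H$ is the intersection graph of $\{\beta^{-1}(v):v\in V(H)\}$ (i.e. distinct $u,v$ are adjacent in $H$ iff $\beta^{-1}(u)\cap\beta^{-1}(v)\ne\emptyset$). A chordal completion of $G$ is a chordal supergraph of $G$ on the same vertex set. A tree-decomposition of $G$ is a representation $(T,\beta)$ of a chordal completion $H$ of $G$. It separates a non-edge $e$ of $G$ if $e$ is a non-edge of that $H$. A family of tree-decompositions of $G$ is non-edge-separating if every non-edge of $G$ is separated by some member of the family. Median graphs, convexity, tree-dimension. $d(u,v)$ is the length of a shortest $(u,v)$-path, and $I(u,v)=\{x: d(u,v)=d(u,x)+d(x,v)\}$. A graph $M$ is a median graph if it is connected and for every three distinct vertices $u,v,w$ the set $I(u,v)\cap I(u,w)\cap I(v,w)$ consists of exactly one vertex. A set $S\subseteq V(G)$ is convex if $I(u,v)\subseteq S$ for all $u,v\in S$; a subgraph is convex if its vertex set is convex. The Cartesian product $G\,\Box\,H$ has vertex set $V(G)\times V(H)$, with $(v_1,h_1),(v_2,h_2)$ adjacent iff $v_1=v_2$ and $h_1h_2\in E(H)$, or $h_1=h_2$ and $v_1v_2\in E(G)$. The tree-dimension of a graph is the minimum $k$ such that the graph has an isometric (distance-preserving) embedding into the Cartesian product of $k$ trees (infinite if none exists). Tree-median-dimension. For a positive integer $k$, a graph $H$ has property $\mathcal{M}_k$ if it is the intersection graph of a family of convex subgraphs of a median graph of tree-dimension $k$. A representation of such an $H$ is a pair $(M,\gamma)$ where $M$ is a median graph of tree-dimension $k$ and $\gamma:V(M)\to 2^{V(H)}$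 is such that for every $v\in V(H)$ the set $\gamma^{-1}(v)=\{x\in V(M):v\in\gamma(x)\}$ is nonempty and convex in $M$, and $H$ is the intersection graph of $\{\gamma^{-1}(v):v\in V(H)\}$. A $k$-tree-median-decomposition of $G$ is a representation $(M,\gamma)$ of a supergraph $H$ of $G$ with $V(H)=V(G)$ having property $\mathcal{M}_k$; it is complete if $\gamma(x)$ is a clique of $G$ for every $x\in V(M)$. The tree-median-dimension of $G$ is the minimum integer $k$ such that $G$ has a complete $k$-tree-median-decomposition. *)

(* Defs.v *)
From HB Require Import structures.
From mathcomp Require Import all_boot.

Set Implicit Arguments.
Unset Strict Implicit.
Unset Printing Implicit Defensive.

(* Every minimum in this development ranges over positive integers. *)
Definition least_pos (P : nat -> Prop) (k : nat) : Prop :=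
  [/\ 0 < k, P k & forall j, 0 < j -> P j -> k <= j].

Record graph (V : finType) := Graph {
  edge :> rel V;
  edge_sym : symmetric edge;
  edge_irr : irreflexive edge }.

Section Basics.
Variables (V : finType) (G : graph V).
Implicit Types (u v x : V) (S : {set V}) (s : seq V).

Definition non_edge u v : bool := (u != v) && ~~ G u v.

Definition clique S : Prop := {in S &, forall u v, u != v -> G u v}.

Definition hole s : Prop :=
  [/\ 4 <= size s, ucycle G s &
      {in s &, forall x y, G x y -> y = next s x \/ x = next s y}].

Definition chordal : Prop := forall s, ~ hole s.

(* The subgraph of G induced by S is connected; in particular S is nonempty. *)
Definition connected_set S : Prop :=
  S != set0 /\ {in S &, forall u v, connect [rel x y in S | G x y] u v}.

Definition connected : Prop := connected_set [set: V].

Definition acyclic : Prop := forall s, 3 <= size s -> ~ ucycle G s.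

Definition tree : Prop := connected /\ acyclic.

(* A shortest path has fewer than #|V| edges, so the search range suffices;
   the value is #|V| when u and v lie in different components. *)
Definition dist u v : nat :=
  find (fun n => [exists p : n.-tuple V, path G u p && (last u p == v)])
       (iota 0 #|V|).

Definition interval u v : {set V} :=
  [set x | dist u v == dist u x + dist x v].

Definition convex S : Prop := {in S &, forall u v, interval u v \subset S}.

Definition median : Prop :=
  connected /\
  forall u v w, u != v -> u != w -> v != w ->
    #|interval u v :&: interval u w :&: interval v w| = 1.

Lemma dist_le u p : path G u p -> dist u (last u p) <= size p.
Proof.
move=> Gp; rewrite leqNgt; apply/negP => lt_p.
have lt_pV : size p < #|V|.
  by apply: leq_trans lt_p _; rewrite -[X in _ <= X](size_iota 0) find_size.
have := before_find 0 lt_p; rewrite nth_iota // add0n => /existsP[].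
by exists (in_tuple p); rewrite Gp eqxx.
Qed.

Lemma dist_path u v : connect G u v ->
  exists2 p, path G u p /\ last u p = v & size p = dist u v.
Proof.
case/connectP=> q0 Gq0 ->; case: (shortenP Gq0) => q Gq Uq _.
have lt_qV : size q < #|V|.
  by have := max_card (mem (u :: q)); rewrite (card_uniqP Uq).
have le_dq := dist_le Gq.
pose P n := [exists p : n.-tuple V, path G u p && (last u p == last u q)].
have hasP : has P (iota 0 #|V|).
  rewrite has_find size_iota; exact: leq_ltn_trans le_dq lt_qV.
have := nth_find 0 hasP; rewrite nth_iota ?add0n; last first.
  exact: leq_ltn_trans le_dq lt_qV.
by case/existsP=> p /andP[Gp /eqP lp]; exists p; rewrite ?size_tuple.
Qed.

End Basics.

Definition intersection_graph (V X : finType) (G : graph V)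
    (F : V -> {set X}) : Prop :=
  (forall v, F v != set0) /\
  (forall u v, u != v -> G u v = (F u :&: F v != set0)).

(* The vertex sets of the G i and of G live in a common universe X via the
   injections f i and g; V(G) and E(G) are the intersections of the V(G i)
   and of the E(G i) there. *)
Definition intersection_of (V : finType) (G : graph V) (k : nat)
    (W : 'I_k -> finType) (H : forall i, graph (W i)) : Prop :=
  exists (X : Type) (f : forall i, W i -> X) (g : V -> X),
  [/\ forall i, injective (f i), injective g,
      forall z, (exists v, g v = z) <-> (forall i, exists w, f i w = z) &
      forall u v, G u v <->
        (forall i, exists x y, [/\ f i x = g u, f i y = g v & H i x y])].

Definition has_chordality (V : finType) (G : graph V) : nat -> Prop :=
  least_pos (fun k => exists (W : 'I_k -> finType) (H : forall i, graph (W i)),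
    (forall i, chordal (H i)) /\ intersection_of G H).

Definition fiber (V X : finType) (b : X -> {set V}) (v : V) : {set X} :=
  [set x | v \in b x].

Definition chordal_representation (V N : finType) (H : graph V)
    (T : graph N) (b : N -> {set V}) : Prop :=
  [/\ chordal H, tree T, forall v, connected_set T (fiber b v) &
      intersection_graph H (fiber b)].

Definition chordal_completion (V : finType) (G H : graph V) : Prop :=
  chordal H /\ subrel G H.

(* td_completion is determined by td_tree and td_bag. *)
Record tree_decomposition (V : finType) (G : graph V) := TreeDecomposition {
  td_node : finType;
  td_tree : graph td_node;
  td_bag : td_node -> {set V};
  td_completion : graph V;
  td_completionP : chordal_completion G td_completion;
  td_representation : chordal_representation td_completion td_tree td_bag }.

Definition separates (V : finType) (G : graph V) (D : tree_decomposition G)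
    (u v : V) : bool := non_edge (td_completion D) u v.

Definition non_edge_separating (V : finType) (G : graph V) (k : nat)
    (D : 'I_k -> tree_decomposition G) : Prop :=
  forall u v, non_edge G u v -> exists i, separates (D i) u v.

Section Product.
Variables (k : nat) (W : 'I_k -> finType) (G : forall i, graph (W i)).

Definition prod_edge : rel {dffun forall i, W i} := fun x y =>
  [exists i, G i (x i) (y i) && [forall j, (j != i) ==> (x j == y j)]].

Lemma prod_edge_sym : symmetric prod_edge.
Proof.
move=> x y; apply/eq_existsb => i; rewrite edge_sym; congr (_ && _).
by apply/eq_forallb => j; rewrite eq_sym [x j == _]eq_sym.
Qed.

Lemma prod_edge_irr : irreflexive prod_edge.
Proof. by move=> x; apply/existsP=> -[i]; rewrite edge_irr. Qed.

Definition cartesian_product : graph {dffun forall i, W i} :=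
  Graph prod_edge_sym prod_edge_irr.

End Product.

(* Vertices at infinite distance must stay at infinite distance. *)
Definition isometric (V W : finType) (G : graph V) (H : graph W)
    (f : V -> W) : Prop :=
  forall u v, connect G u v = connect H (f u) (f v) /\
    (connect G u v -> dist G u v = dist H (f u) (f v)).

Definition has_tree_dimension (V : finType) (G : graph V) : nat -> Prop :=
  least_pos (fun k => exists (N : 'I_k -> finType) (T : forall i, graph (N i)),
    (forall i, tree (T i)) /\
    exists f : V -> {dffun forall i, N i},
      isometric G (cartesian_product T) f).

Definition tree_product_intersection (V : finType) (G : graph V) (k : nat) :
    Prop :=
  exists (N : 'I_k -> finType) (T : forall i, graph (N i)),
    (forall i, tree (T i)) /\
    exists F : V -> {set {dffun forall i, N i}},
      (forall v, convex (cartesian_product T) (F v)) /\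
      intersection_graph G F.

Definition property_M (V : finType) (k : nat) (H : graph V) : Prop :=
  exists (X : finType) (M : graph X) (F : V -> {set X}),
    [/\ median M, has_tree_dimension M k, forall v, convex M (F v) &
        intersection_graph H F].

Definition median_representation (V X : finType) (k : nat) (H : graph V)
    (M : graph X) (c : X -> {set V}) : Prop :=
  [/\ median M, has_tree_dimension M k, forall v, convex M (fiber c v) &
      intersection_graph H (fiber c)].

Definition tree_median_decomposition (V X : finType) (k : nat) (G : graph V)
    (M : graph X) (c : X -> {set V}) : Prop :=
  exists H : graph V,
    [/\ subrel G H, property_M k H & median_representation k H M c].

Definition complete_decomposition (V X : finType) (G : graph V)
    (c : X -> {set V}) : Prop := forall x, clique G (c x).

Definition has_tree_median_dimension (V : finType) (G : graph V) :
    nat -> Prop :=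
  least_pos (fun k => exists (X : finType) (M : graph X) (c : X -> {set V}),
    tree_median_decomposition k G M c /\ complete_decomposition G c).

(* Main.v *)
Require Import Defs.
From mathcomp Require Import all_boot.
From mathcomp Require Import zify.
From Stdlib Require Import Classical_Prop.

Set Implicit Arguments.
Unset Strict Implicit.
Unset Printing Implicit Defensive.

(** All five parameters measure the same thing: how many trees are needed to
    write [G] as a conjunction of intersection graphs of subtrees. The common
    form is [subtree_model]: trees [T i] and subtrees [F i v] such that [u] and
    [v] are adjacent exactly when [F i u] meets [F i v] for every [i].

    Chordality and tree-decompositions. The intersection graph of subtrees of
    a tree is chordal ([subtree_graph_chordal], by looking at the subtree whose
    top is deepest), and every chordal graph arises in this way
    ([chordal_representation_exists], by removing simplicial vertices, which
    exist by Dirac's argument on minimal separators). A graph is an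
    intersection of chordal graphs exactly when it is one of chordal
    completions, obtained by pulling the given graphs back to its own vertex
    set; and a family of tree-decompositions separates the non-edges exactly
    when the intersection of the completions is [G].

    Products of trees. In a product of connected graphs the distance is the
    sum of the distances of the coordinates ([prod_dist]), so that intervals
    are products of intervals. A box of subtrees is therefore convex, and two
    boxes meet as soon as their sides do; this turns a [subtree_model] into
    convex subgraphs of a product. A product of trees is moreover a median
    graph, because a tree is one ([tree_median]).

    Median graphs. The step back, [subtree_model_of_median], serves products of
    trees and median graphs of given tree-dimension alike: it takes a median
    graph [M] isometrically embedded in a product of trees and replaces each
    convex set by its projections to the trees. Disjoint convex sets keep
    disjoint projections in some tree, because convex sets of a median graph
    are gated ([gate]).

    The tree-dimension of a product of [k] trees may be smaller than [k], so
    that the parameters are not compared for each value but only as minima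
    ([least_pos_transfer]). *)

(** * Paths, distances and intervals *)

Lemma connect_map (X Y : finType) (r : rel X) (r' : rel Y) (h : X -> Y) a b :
  (forall x y, r x y -> connect r' (h x) (h y)) ->
  connect r a b -> connect r' (h a) (h b).
Proof.
move=> rr' /connectP[p rp ->]; elim: p a rp => [|c p IHp] a //= /andP[rac rp].
exact: connect_trans (rr' _ _ rac) (IHp _ rp).
Qed.

Section Distance.
Variables (V : finType) (G : graph V).
Implicit Types (u v w x : V) (S : {set V}) (p : seq V).

Lemma connect_in_sym S : connect_sym [rel x y in S | G x y].
Proof.
apply: sym_connect_sym => x y /=.
by rewrite (edge_sym G) [(x \in S) && _]andbC.
Qed.

Lemma path_in S u p : u \in S ->
  path [rel x y in S | G x y] u p = path G u p && all [in S] p.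
Proof.
elim: p u => //= a p IHp u Su; rewrite Su /=.
by case Sa: (a \in S); rewrite /= ?andbF // IHp // andbA.
Qed.

Lemma connected_set_hub S h :
  h \in S -> {in S, forall u, connect [rel x y in S | G x y] h u} ->
  connected_set G S.
Proof.
move=> Sh hub; split=> [|u v Su Sv]; first by apply/set0Pn; exists h.
by apply: connect_trans (hub v Sv); rewrite connect_in_sym hub.
Qed.

Lemma connected_connect : connected G -> forall u v, connect G u v.
Proof.
case=> _ conG u v; have := conG u v (in_setT _) (in_setT _).
apply: connect_sub => x y /= /andP[_]; exact: connect1.
Qed.

Lemma connect_connected h : (forall u, connect G h u) -> connected G.
Proof.
move=> hub; apply: (@connected_set_hub _ h) => // u _.
apply: connect_sub (hub u) => x y Gxy.
by apply: connect1; rewrite /= !inE.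
Qed.

Lemma dist_path_le u v p : path G u p -> last u p = v -> dist G u v <= size p.
Proof. by move=> Gp <-; exact: dist_le. Qed.

Lemma distuu u : dist G u u = 0.
Proof. by apply/eqP; rewrite -leqn0; exact: (@dist_path_le u u [::]). Qed.

Lemma dist_tri u v w : connect G u v -> connect G v w ->
  dist G u w <= dist G u v + dist G v w.
Proof.
move=> /dist_path[p [Gp lp] <-] /dist_path[q [Gq lq] <-].
rewrite -size_cat; apply: dist_path_le; first by rewrite cat_path Gp lp.
by rewrite last_cat lp.
Qed.

Lemma dist_edge u v : G u v -> dist G u v <= 1.
Proof. by move=> Guv; apply: (@dist_path_le u v [:: v]); rewrite /= ?Guv. Qed.

(** A shortest path visits its vertices in the order of their distance from
    its origin, so that a repetition or a chord would contradict minimality. *)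
Lemma geodesic_dist u p i : path G u p -> size p = dist G u (last u p) ->
  i <= size p -> dist G u (nth u (u :: p) i) = i.
Proof.
move=> Gp sp le_ip; apply/eqP; rewrite eqn_leq.
have lx : nth u (u :: p) i = last u (take i p).
  rewrite (last_nth u) size_takel //; case: i le_ip => [|i] lei //=.
  by rewrite nth_take.
have := Gp; rewrite -{1}(cat_take_drop i p) cat_path -lx => /andP[Gt Gd].
have ld : last (nth u (u :: p) i) (drop i p) = last u p.
  by rewrite lx -last_cat cat_take_drop.
have lt : dist G u (nth u (u :: p) i) <= i.
  by rewrite (leq_trans (dist_path_le Gt (esym lx))) // size_takel.
have ld2 := dist_path_le Gd ld; rewrite size_drop in ld2.
have cu : connect G u (nth u (u :: p) i).
  by apply/connectP; exists (take i p).
have cl : connect G (nth u (u :: p) i) (last u p).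
  by apply/connectP; exists (drop i p).
by have := dist_tri cu cl; lia.
Qed.

Lemma geodesic_uniq u p : path G u p -> size p = dist G u (last u p) ->
  uniq (u :: p).
Proof.
move=> Gp sp; apply/(uniqP u) => i j; rewrite !inE /= !ltnS => lei lej eq_ij.
by rewrite -(geodesic_dist Gp sp lei) -(geodesic_dist Gp sp lej) eq_ij.
Qed.

Lemma geodesic_index u p a : path G u p -> size p = dist G u (last u p) ->
  a \in u :: p -> index a (u :: p) = dist G u a.
Proof.
move=> Gp sp pa; rewrite -[X in dist _ _ X](nth_index u pa).
by rewrite (geodesic_dist Gp sp) // -ltnS; move: pa; rewrite -index_mem.
Qed.

Lemma intervalP u v x :
  reflect (dist G u v = dist G u x + dist G x v) (x \in interval G u v).
Proof. by rewrite inE; exact: eqP. Qed.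

Hypothesis conG : forall u v, connect G u v.

Lemma dist_triangle u v w : dist G u w <= dist G u v + dist G v w.
Proof. exact: dist_tri. Qed.

Lemma dist0_eq u v : dist G u v = 0 -> u = v.
Proof. by case: (dist_path (conG u v)) => -[|a p] [_ <-] // <-. Qed.

Lemma dist_sym u v : dist G u v = dist G v u.
Proof.
wlog suff le_d : u v / dist G u v <= dist G v u.
  by apply/eqP; rewrite eqn_leq !le_d.
case: (dist_path (conG v u)) => p [Gp lp] <-.
rewrite -[size p](size_belast v) -size_rev; apply: dist_path_le; last first.
  by case: p Gp lp => [|a p] //= _ <-; rewrite rev_cons last_rcons.
rewrite -lp rev_path; apply: sub_path Gp => x y; by rewrite (edge_sym G).
Qed.

Lemma geodesic u v :
  exists p, [/\ path G u p, last u p = v, size p = dist G u v & uniq (u :: p)].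
Proof.
case: (dist_path (conG u v)) => p [Gp lp] sp; exists p; split=> //.
by apply: geodesic_uniq; rewrite ?lp.
Qed.

Lemma geodesic_sub u p x : path G u p -> size p = dist G u (last u p) ->
  x \in u :: p -> x \in interval G u (last u p).
Proof.
move=> Gp sp px; apply/intervalP.
case/splitPl: px Gp sp => p1 p2 lx; rewrite cat_path last_cat size_cat lx.
move=> /andP[Gp1 Gp2] sp.
have := dist_path_le Gp1 lx; have := dist_path_le Gp2 erefl.
by have := dist_triangle u x (last x p2); lia.
Qed.

Lemma interval_left u v : u \in interval G u v.
Proof. by apply/intervalP; rewrite distuu. Qed.

Lemma interval_right u v : v \in interval G u v.
Proof. by apply/intervalP; rewrite distuu addn0. Qed.

Lemma interval_sym u v : interval G u v = interval G v u.
Proof.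
apply/setP=> x; rewrite !inE (dist_sym v u) (dist_sym v x) (dist_sym x u).
by rewrite addnC.
Qed.

Lemma interval_trans u v m x :
  m \in interval G u v -> x \in interval G u m -> x \in interval G u v.
Proof.
move=> /intervalP dm /intervalP dx; apply/intervalP.
have := dist_triangle x m v; have := dist_triangle u x v; lia.
Qed.

Lemma convex_connected S : S != set0 -> convex G S -> connected_set G S.
Proof.
move=> S0 cS; split=> // u v Su Sv; case: (geodesic u v) => p [Gp lp sp Up].
have Sp : {in u :: p, forall x, x \in S}.
  move=> x px; apply: (subsetP (cS u v Su Sv)); rewrite -lp.
  by apply: geodesic_sub; rewrite ?lp.
apply/connectP; exists p => //; rewrite path_in // Gp /=.
by apply/allP=> x px; apply: Sp; rewrite inE px orbT.
Qed.

(** A point of a convex set at minimal distance from [r] is a gate: the median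
    of [r], [t] and a further point [w] lies in the set and is at least as
    close to [r] as [t], hence is [t]. *)
Lemma gate S r t w :
    (forall a b c, exists m,
       m \in interval G a b :&: interval G a c :&: interval G b c) ->
    convex G S -> t \in S -> {in S, forall s, dist G r t <= dist G r s} ->
  w \in S -> t \in interval G r w.
Proof.
move=> med cS St min_t Sw; case: (med r t w) => m.
rewrite 2!inE => /andP[/andP[/intervalP rt rw] tw].
have := min_t m (subsetP (cS t w St Sw) m tw) => le_m.
have /dist0_eq <- // : dist G m t = 0 by lia.
Qed.

End Distance.

(** * Trees *)

Section Tree.
Variables (V : finType) (G : graph V).
Hypothesis treeG : tree G.
Implicit Types (u v w x : V) (S : {set V}) (p : seq V).

Let conG : forall u v, connect G u v.
Proof. by apply: connected_connect; case: treeG. Qed.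

(** Two branches at [u] joined by a walk avoiding [u] would close a cycle. *)
Lemma tree_branch u a b : G u a -> G u b ->
  connect [rel x y in ~: [set u] | G x y] a b -> a = b.
Proof.
move=> Gua Gub /connectP[p0 Gp0 lb]; case/shortenP: Gp0 lb => p Gp Up _ lb.
case: p Gp Up lb => [|c p] // Gp Up lb.
case: treeG => _ /(_ (u :: a :: c :: p) isT)[].
have Sa : a \in ~: [set u].
  by rewrite !inE; apply: contraTN Gua => /eqP ->; rewrite edge_irr.
move: Gp; rewrite path_in // => /andP[Gp Sp].
have up : u \notin a :: c :: p.
  have /allP Sall : all [in ~: [set u]] (a :: c :: p) by rewrite /= Sa.
  by apply/negP=> /Sall; rewrite /= !inE eqxx.
rewrite /ucycle cons_uniq up Up andbT (cycle_path u) /=.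
move: Gp => /= ->; rewrite Gua -[last c p]/(last a (c :: p)) -lb.
by rewrite edge_sym Gub.
Qed.

(** Two simple paths between the same ends that part at [u] would give two
    branches at [u] joined through the other end. *)
Lemma tree_path_unique u p q : path G u p -> path G u q ->
  uniq (u :: p) -> uniq (u :: q) -> last u p = last u q -> p = q.
Proof.
have avoid v a r : a != v -> v \notin r -> path G a r ->
    connect [rel x y in ~: [set v] | G x y] a (last a r).
  move=> av vr Gr; apply/connectP; exists r => //.
  rewrite path_in ?inE // Gr; apply/allP=> x rx; rewrite !inE.
  by apply: contraNneq vr => <-.
elim: p u q => [|a p IHp] u [|b q] // Gp Gq Up Uq eq_l.
- by case/andP: Uq; move: eq_l => /= {1}->; rewrite mem_last.
- by case/andP: Up; move: eq_l => /= {1}<-; rewrite mem_last.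
move: Gp Gq => /= /andP[Gua Gp] /andP[Gub Gq].
case/andP: Up; rewrite inE negb_or => /andP[ua up] Up.
case/andP: Uq; rewrite inE negb_or => /andP[ub uq] Uq.
have eq_ab : a = b.
  apply: (tree_branch Gua Gub).
  apply: connect_trans (avoid u a p _ up Gp) _; first by rewrite eq_sym.
  by rewrite [last a p]eq_l connect_in_sym avoid // eq_sym.
by subst b; congr (_ :: _); apply: (IHp a).
Qed.

(** A connected set contains a simple path between any two of its points, and
    there is no other simple path than the geodesic. *)
Lemma tree_connected_convex S : connected_set G S -> convex G S.
Proof.
case=> _ cS u v Su Sv; apply/subsetP=> x /intervalP dx.
case/connectP: (cS u v Su Sv) => p0 Sp0 lv.
case/shortenP: Sp0 lv => p Sp Up _ lv.
case: (geodesic conG u x) => q1 [Gq1 lq1 sq1 _].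
case: (geodesic conG x v) => q2 [Gq2 lq2 sq2 _].
have Gq : path G u (q1 ++ q2) by rewrite cat_path Gq1 lq1.
have lq : last u (q1 ++ q2) = v by rewrite last_cat lq1.
have Uq : uniq (u :: q1 ++ q2).
  by apply: (geodesic_uniq Gq); rewrite lq size_cat sq1 sq2.
move: Sp; rewrite path_in // => /andP[Gp Sp].
have eq_pq : p = q1 ++ q2.
  by apply: (tree_path_unique Gp Gq Up Uq); rewrite lq -lv.
have: x \in u :: p by rewrite eq_pq -cat_cons mem_cat -lq1 mem_last.
by rewrite inE => /predU1P[-> // | /(allP Sp)].
Qed.

(** Both geodesics from [r] to [z], through [p] and through [q], are the same
    path, on which [p] comes first. *)
Lemma tree_interval_linear r z (p q : V) :
  p \in interval G r z -> q \in interval G r z -> dist G r p <= dist G r q ->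
  q \in interval G p z.
Proof.
move=> /intervalP dp /intervalP dq le_pq.
have through x : dist G r z = dist G r x + dist G x z -> exists s1 s2,
    [/\ path G r (s1 ++ s2), last r (s1 ++ s2) = z, uniq (r :: s1 ++ s2),
       last r s1 = x & size s1 = dist G r x].
  move=> dx; case: (geodesic conG r x) => s1 [G1 l1 n1 _].
  case: (geodesic conG x z) => s2 [G2 l2 n2 _]; exists s1, s2.
  have Gs : path G r (s1 ++ s2) by rewrite cat_path G1 l1.
  have ls : last r (s1 ++ s2) = z by rewrite last_cat l1.
  by split=> //; apply: (geodesic_uniq Gs); rewrite ls size_cat n1 n2.
case: (through p dp) => p1 [p2 [Gp lp Up l1p n1p]].
case: (through q dq) => q1 [q2 [Gq lq Uq l1q n1q]].
have eq_s : p1 ++ p2 = q1 ++ q2.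
  by apply: (tree_path_unique Gp Gq Up Uq); rewrite lp lq.
have q1E : q1 = p1 ++ drop (size p1) q1.
  rewrite -{1}(cat_take_drop (size p1) q1); congr (_ ++ _).
  have := congr1 (take (size p1)) eq_s.
  by rewrite take_size_cat // takel_cat // n1p n1q.
have Gd : path G p (drop (size p1) q1).
  by move: Gq; rewrite {1}q1E -catA !cat_path l1p => /and3P[].
have ld : last p (drop (size p1) q1) = q by rewrite -l1p -last_cat -q1E.
have := dist_path_le Gd ld; rewrite size_drop n1p n1q => le_d.
apply/intervalP.
by have := dist_triangle conG p q z; lia.
Qed.

(** The median is the point of the geodesic from [u] to [v] closest to [w]. It
    is the only one since the pairwise distances of [u], [v] and [w] determine
    its position on that geodesic. *)
Lemma tree_median u v w : exists m,
  interval G u v :&: interval G u w :&: interval G v w = [set m].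
Proof.
have [m Pm min_m] : exists2 m, m \in interval G u v &
    {in interval G u v, forall x, dist G w m <= dist G w x}.
  by case: (arg_minnP (dist G w) (interval_left G u v)) => m; exists m.
(* A geodesic from an end to [m] and one from [m] to [w] meet only in [m],
   by the choice of [m]; their concatenation is thus the only simple path. *)
have branch a b : interval G a b = interval G u v -> m \in interval G a w.
  move=> eq_ab; case: (geodesic conG a m) => p [Gp lp sp Up].
  case: (geodesic conG m w) => q [Gq lq sq Uq].
  case: (geodesic conG a w) => s [Gs ls ss Us].
  have Gpq : path G a (p ++ q) by rewrite cat_path Gp lp.
  have Upq : uniq (a :: p ++ q).
    rewrite -cat_cons cat_uniq Up; move: Uq => /= /andP[mq ->]; rewrite andbT.
    apply/hasPn=> x qx; apply/negP=> px; case/negP: mq.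
    have Ix : x \in interval G u v.
      rewrite -eq_ab; apply: (@interval_trans _ _ conG a b m).
        by rewrite eq_ab.
      by rewrite -lp; apply: geodesic_sub; rewrite // lp.
    have: x \in interval G m w.
      by rewrite -lq; apply: geodesic_sub; rewrite ?lq // inE qx orbT.
    move/intervalP; have := min_m x Ix.
    rewrite !(dist_sym conG w) => le_d dx.
    by have /(dist0_eq conG) -> : dist G m x = 0 by lia.
  have := @tree_path_unique a s (p ++ q) Gs Gpq Us Upq.
  rewrite last_cat lp ls lq => /(_ erefl) eq_s; apply/intervalP.
  by rewrite -ss eq_s size_cat sp sq.
have uw := branch u v erefl; have vw := branch v u (interval_sym conG v u).
exists m; apply/setP=> x; rewrite !in_setI in_set1.
apply/andP/eqP=> [[/andP[xuv xuw] xvw]|->]; last by rewrite Pm uw vw.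
have dux : dist G u m = dist G u x.
  move: xuv xuw xvw Pm uw vw => /intervalP ? /intervalP ? /intervalP ?.
  move=> /intervalP ? /intervalP ? /intervalP ?.
  by have := dist_sym conG v x; have := dist_sym conG v m; lia.
have /intervalP := tree_interval_linear Pm xuv (eq_leq dux).
move/intervalP: xuv; move/intervalP: Pm => dm dx dmx.
by apply/esym/(dist0_eq conG); lia.
Qed.
End Tree.

Lemma median_exists (V : finType) (M : graph V) : median M ->
  forall a b c, exists m,
    m \in interval M a b :&: interval M a c :&: interval M b c.
Proof.
case=> /connected_connect conM med a b c.
have [->|ab] := eqVneq a b.
  by exists b; rewrite !in_setI interval_left // !interval_left.
have [->|ac] := eqVneq a c.
  by exists c; rewrite !in_setI interval_left // !interval_right.
have [->|bc] := eqVneq b c.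
  by exists c; rewrite !in_setI !interval_right.
have /eqP/cards1P[m mP] := med a b c ab ac bc.
by exists m; rewrite mP set11.
Qed.

(** * Cartesian products *)

(** The bound along edges keeps [D] below the length of any path to [z], and
    following the decreasing steps gives a path of that length. *)
Lemma dist_potential (V : finType) (G : graph V) (D : V -> nat) (z : V) :
    D z = 0 -> (forall x y, G x y -> D x <= (D y).+1) ->
    (forall x, D x != 0 -> exists2 y, G x y & D y < D x) ->
    (forall x, D x = 0 -> x = z) ->
  forall x, connect G x z /\ dist G x z = D x.
Proof.
move=> Dz lip step D0 x.
have [n] := ubnP (D x); elim: n x => // n IHn x /ltnSE le_n.
have lower p y : path G y p -> last y p = z -> D y <= size p.
  elim: p y => [y _ /= ->|a p IHp y /= /andP[Gya Gp] lp]; first by rewrite Dz.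
  by apply: leq_trans (lip _ _ Gya) _; rewrite ltnS IHp.
have [x0|xn0] := eqVneq (D x) 0.
  by rewrite (D0 x x0) distuu Dz connect0.
case: (step x xn0) => y Gxy lt_yx.
case: (IHn y (leq_trans lt_yx le_n)) => cyz dyz.
have cxz : connect G x z by apply: connect_trans cyz; exact: connect1.
split=> //; case: (dist_path cxz) => p [Gp lp] sp.
have := lower p x Gp lp; have := dist_tri (connect1 Gxy) cyz.
have := dist_edge Gxy; lia.
Qed.

Section Product.
Variables (k : nat) (W : 'I_k -> finType) (T : forall i, graph (W i)).
Hypothesis conT : forall i u v, connect (T i) u v.
Local Notation P := (cartesian_product T).
Implicit Types x y z : {dffun forall i, W i}.

Lemma prod_edgeP x y :
  reflect (exists i, T i (x i) (y i) /\ forall j, j != i -> x j = y j) (P x y).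
Proof.
apply: (iffP existsP) => -[i].
  case/andP=> Ti /forallP eq_xy; exists i; split=> // j ji.
  by apply/eqP; apply: implyP (eq_xy j) ji.
case=> Ti eq_xy; exists i; rewrite Ti; apply/forallP=> j.
by apply/implyP=> /eq_xy ->.
Qed.

(** A step changes one coordinate, by one edge; and while some coordinate
    differs from its target, it can be moved one step closer. *)
Lemma prod_dist x z :
  connect P x z /\ dist P x z = \sum_i dist (T i) (x i) (z i).
Proof.
move: x; apply: dist_potential.
- by apply: big1 => i _; rewrite distuu.
- move=> x y /prod_edgeP[i [Ti eq_xy]].
  rewrite (bigD1 i) //= [in X in _ <= X.+1](bigD1 i) //= -addSn.
  rewrite (eq_bigr (fun j => dist (T j) (y j) (z j))) => [|j /eq_xy -> //].
  rewrite leq_add2r -add1n.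
  apply: leq_trans (dist_triangle (@conT i) (x i) (y i) (z i)) _.
  by rewrite leq_add2r dist_edge.
- move=> x; rewrite sum_nat_eq0 negb_forall => /existsP[i /= di].
  case: (dist_path (conT (x i) (z i))) => -[|a p] [/= Gp lp] sp.
    by rewrite -sp in di.
  case/andP: Gp => Ga Gp.
  exists [ffun j => dfwith x a j].
    apply/prod_edgeP; exists i; rewrite ffunE dfwith_in; split=> // j ji.
    by rewrite ffunE dfwith_out // eq_sym.
  rewrite (bigD1 i) //= [X in _ < X](bigD1 i) //= ffunE dfwith_in.
  rewrite (eq_bigr (fun j => dist (T j) (x j) (z j))) => [|j ji]; last first.
    by rewrite ffunE dfwith_out // eq_sym.
  by rewrite ltn_add2r -sp ltnS; apply: dist_path_le.
- move=> x /eqP; rewrite sum_nat_eq0 => /forallP d0; apply/ffunP=> i.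
  by apply: (dist0_eq (@conT i)); apply/eqP; exact: d0.
Qed.

Lemma prod_connect x z : connect P x z.
Proof. by case: (prod_dist x z). Qed.

(** The triangle inequalities of the coordinates add up to that of the
    product, and a sum of inequalities is tight only if each of them is. *)
Lemma prod_interval x y z :
  (z \in interval P x y) = [forall i, z i \in interval (T i) (x i) (y i)].
Proof.
rewrite inE !(proj2 (prod_dist _ _)) -big_split /=.
have := @leqif_sum _ xpredT
  (fun i => dist (T i) (x i) (y i) ==
     dist (T i) (x i) (z i) + dist (T i) (z i) (y i))
  (fun i => dist (T i) (x i) (y i))
  (fun i => dist (T i) (x i) (z i) + dist (T i) (z i) (y i)).
case=> [i _|_ ->]; first by split; rewrite // dist_triangle.
by apply: eq_forallb => i; rewrite inE.
Qed.

Lemma box_convex (F : forall i, {set W i}) : (forall i, convex (T i) (F i)) ->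
  convex P [set x : {dffun forall i, W i} | [forall i, x i \in F i]].
Proof.
move=> cF x y; rewrite !inE => /forallP xF /forallP yF; apply/subsetP=> z.
rewrite prod_interval inE => /forallP zI; apply/forallP=> i.
exact: subsetP (cF i _ _ (xF i) (yF i)) _ (zI i).
Qed.
End Product.

Section TreeProduct.
Variables (k : nat) (W : 'I_k -> finType) (T : forall i, graph (W i)).
Hypothesis treeT : forall i, tree (T i).
Local Notation P := (cartesian_product T).

Lemma trees_connect i u v : connect (T i) u v.
Proof. by apply: connected_connect; case: (treeT i). Qed.

Lemma tree_product_connected : connected P.
Proof.
have /fin_all_exists[r _] : forall i, exists x : W i, true.
  by move=> i; case: (treeT i) => -[/set0Pn[x _] _] _; exists x.
pose h : {dffun forall i, W i} := [ffun i => r i].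
apply: (@connect_connected _ P h) => u.
exact: prod_connect trees_connect _ _.
Qed.

Lemma tree_product_median : median P.
Proof.
split=> [|u v w _ _ _]; first exact: tree_product_connected.
have /fin_all_exists[m mP] := fun i => tree_median (treeT i) (u i) (v i) (w i).
pose h : {dffun forall i, W i} := [ffun i => m i].
apply/eqP/cards1P; exists h; apply/setP=> x.
rewrite !in_setI in_set1 !(prod_interval trees_connect).
have mx i : (x i == m i) = (x i \in interval (T i) (u i) (v i)) &&
   (x i \in interval (T i) (u i) (w i)) && (x i \in interval (T i) (v i) (w i)).
  by rewrite -in_set1 -mP !in_setI.
apply/andP/eqP=> [[/andP[/forallP xuv /forallP xuw] /forallP xvw]|xh].
  by apply/ffunP=> i; apply/eqP; rewrite ffunE mx xuv xuw xvw.
have xm i : x i == m i by rewrite xh ffunE.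
split; first (apply/andP; split); apply/forallP=> i;
  by have := xm i; rewrite mx => /andP[/andP[]].
Qed.
End TreeProduct.

(** * Subtree intersection graphs are chordal *)

(** Root the tree, and let the top of a subtree be its point closest to the
    root. Whenever two subtrees meet, the deeper of their two tops belongs to
    both, since the tops lie on the path from the root to a common point. So
    around a vertex of a hole with deepest top, both neighbours contain that
    top and are therefore adjacent. *)
Lemma subtree_graph_chordal (V N : finType) (T : graph N) (F : V -> {set N})
    (H : graph V) :
  tree T -> (forall v, connected_set T (F v)) ->
  (forall u v, u != v -> H u v = (F u :&: F v != set0)) -> chordal H.
Proof.
move=> treeT conF HF s [ge4 /andP[cyc Us] chordless].
have conT : forall u v, connect T u v.
  by apply: connected_connect; case: treeT.
have cF v : convex T (F v) by exact: tree_connected_convex.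
have [r _] : exists r : N, r \in [set: N].
  by case: treeT => -[/set0Pn].
have /fin_all_exists[top topP] v : exists t, t \in F v /\
    {in F v, forall w, t \in interval T r w}.
  case: (conF v) => /set0Pn[t0 Ft0] _.
  case: (arg_minnP (dist T r) Ft0) => t Ft min_t; exists t; split=> // w Fw.
  apply: (gate conT _ (cF v) Ft) => // a b c.
  by case: (tree_median treeT a b c) => m ->; exists m; rewrite set11.
have deeper a v : dist T r (top a) <= dist T r (top v) -> H a v ->
    top v \in F a.
  move=> le_av Hav; have av : a != v.
    by apply: contraTneq Hav => ->; rewrite edge_irr.
  move: Hav; rewrite HF // => /set0Pn[z]; rewrite inE => /andP[az vz].
  case: (topP a) (topP v) => Fa Ia [_ Iv].
  apply: (subsetP (cF a _ _ Fa az)).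
  exact: (tree_interval_linear treeT (Ia z az) (Iv z vz)).
have [x0 sx0] : exists x0, x0 \in s.
  by case: s ge4 {cyc Us chordless} => // x0 s _; exists x0; rewrite mem_head.
case: (@arg_maxnP _ x0 [in s] (fun v => dist T r (top v)) sx0) => v sv max_v.
case: (rot_to sv) => i s' rot_s.
have sE x : (x \in v :: s') = (x \in s) by rewrite -rot_s mem_rot.
have nextE x : next (v :: s') x = next s x by rewrite -rot_s next_rot.
(* Turn the hole so that it starts with [v]: its neighbours are then the
   second vertex [a] and the last one [b], which comes after [c]. *)
move: ge4 Us cyc; rewrite -(size_rot i) -(rot_uniq i) -(rot_cycle i) rot_s.
case: s' {rot_s} sE nextE => [|a [|c [|d s']]] // sE nextE _ Us cyc.
set b := last d s'.
have sa : a \in s by rewrite -sE !inE eqxx orbT.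
have db : b \in d :: s' by rewrite mem_last.
have sb : b \in s.
  by rewrite -sE -[_ :: _]/([:: v; a; c] ++ d :: s') mem_cat db orbT.
have [Hva Hbv] : H v a /\ H b v.
  by move: cyc; rewrite (cycle_path v) /= -/b => /andP[-> /andP[->]].
have /and4P[vn an cn _] := Us.
have ab : a != b by apply: contraNneq an => ->; rewrite in_cons db orbT.
have Hab : H a b.
  rewrite HF //; apply/set0Pn; exists (top v); rewrite inE.
  apply/andP; split; apply: deeper; rewrite ?Hbv ?(edge_sym H a) ?Hva //;
  exact: max_v.
case: (chordless a b sa sb Hab); rewrite -nextE.
  rewrite /= eqxx; case: eqP => [av|_ bc]; last by rewrite -bc db in cn.
  by rewrite av mem_head in vn.
move/(congr1 (prev [:: v, a, c, d & s'])); rewrite prev_next //= eqxx => vb.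
by rewrite vb !in_cons -in_cons db !orbT in vn.
Qed.

(** * Chordal graphs have simplicial vertices *)

Section SimplicialVertex.
Variables (V : finType) (G : graph V).
Hypothesis chG : chordal G.
Implicit Types (A C D : {set V}) (u v x y z : V).

Definition simplicial A y : Prop := clique G [set z in A | G y z].

(** Otherwise [x] together with a shortest path from [s] to [t] through [C]
    is a hole. *)
Lemma separator_adjacent C s t x : s != t -> G x s -> G x t ->
    {in C, forall c, c != x /\ ~~ G x c} ->
    connect [rel u v in s |: (t |: C) | G u v] s t ->
  G s t.
Proof.
move=> st xs xt xC con; apply/negPn/negP=> nst.
set D := s |: (t |: C) in con.
pose e : rel V := [rel u v in D | G u v].
have e_sym : symmetric e.
  by move=> u v; rewrite /e /= (edge_sym G) [(u \in D) && _]andbC.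
have e_irr : irreflexive e by move=> u; rewrite /e /= edge_irr andbF.
(* Distances are taken in [D] since a shortest path in [G] could leave it. *)
have [GD GDE] : exists GD : graph V, edge GD = e by exists (Graph e_sym e_irr).
have [p [Gp lp] sp] :
    exists2 p, path GD s p /\ last s p = t & size p = dist GD s t.
  by apply: dist_path; rewrite GDE.
rewrite -lp in sp; have Up := geodesic_uniq Gp sp.
have Ds : s \in D by rewrite !inE eqxx.
move: (Gp); rewrite GDE [path _ _ _](path_in G p Ds) => /andP[Gp' /allP Dp].
have {}Dp a : a \in s :: p -> a \in D by rewrite in_cons => /predU1P[->|/Dp].
have xD : x \notin D.
  rewrite !inE !negb_or; apply/and3P; split.
  - by apply: contraTneq xs => ->; rewrite edge_irr.
  - by apply: contraTneq xt => ->; rewrite edge_irr.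
  - by apply/negP=> /xC[]; rewrite eqxx.
have nx : x \notin s :: p by apply: contra xD; exact: Dp.
have Uh : uniq (x :: s :: p) by rewrite cons_uniq nx.
(* The distance from [s] in [D] is the position on the path, so that an edge
   of [G] joins only consecutive vertices of it. *)
have next_p a : a \in s :: p ->
    next (x :: s :: p) a = nth x (s :: p) (dist GD s a).+1.
  move=> pa; rewrite -(geodesic_index Gp sp pa) next_nth in_cons pa orbT.
  rewrite [index _ _]/=; case: eqP => // xa.
  by rewrite xa pa in nx.
have nth_dist a : a \in s :: p -> nth x (s :: p) (dist GD s a) = a.
  by move=> pa; rewrite -(geodesic_index Gp sp pa) nth_index.
have xb b : b \in s :: p -> G x b ->
    b = next (x :: s :: p) x \/ x = next (x :: s :: p) b.
  move=> pb Gxb; have := Dp b pb; rewrite !in_setU !in_set1.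
  case/or3P=> [/eqP->|/eqP->|/xC[_]]; last by rewrite Gxb.
    by left; rewrite /= eqxx.
  right; rewrite next_p -lp ?mem_last // -sp nth_default //.
have ab a b : a \in s :: p -> b \in s :: p -> G a b ->
    dist GD s a <= dist GD s b -> b = next (x :: s :: p) a.
  move=> pa pb Gab le_ab; rewrite next_p // -[LHS]nth_dist //.
  have eab : GD a b.
    by rewrite GDE; apply/andP; split=> //; apply/andP; split; exact: Dp.
  have le1 := dist_edge eab.
  have cona : connect GD s a := path_connect Gp pa.
  have tri := dist_tri cona (connect1 eab).
  have [eq_d|ne_d] := eqVneq (dist GD s a) (dist GD s b).
    by move: Gab; rewrite -(nth_dist a) // eq_d nth_dist // edge_irr.
  have d1 : dist GD s b <= (dist GD s a).+1.
    by apply: leq_trans tri _; rewrite -addn1 leq_add2l.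
  by congr (nth _ _ _); apply/eqP; rewrite eqn_leq d1 ltn_neqAle ne_d le_ab.
apply: (chG (s := x :: s :: p)); split.
- case: p lp Gp' {sp Up Gp Dp nx Uh next_p nth_dist xb ab} => [|c [|d p]] //=.
    by move=> st'; rewrite st' eqxx in st.
  by move=> ->; rewrite (negPf nst).
- rewrite /ucycle Uh andbT (cycle_path x) /= lp xs Gp'.
  by rewrite (edge_sym G) xt.
move=> a b; rewrite ![_ \in x :: _]in_cons.
case/predU1P=> [->|pa]; case/predU1P=> [->|pb] Gab.
- by rewrite edge_irr in Gab.
- exact: xb.
- have Gxa : G x a by rewrite (edge_sym G).
  by case: (xb a pa Gxa); [right|left].
case: (leqP (dist GD s a) (dist GD s b)) => [le_d|/ltnW le_d].
  by left; exact: (ab _ _ pa pb).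
by right; apply: (ab _ _ pb pa _ le_d); rewrite (edge_sym G).
Qed.

(** By induction on [A]. Let [C] be a component of the non-neighbours of [x]
    and [S] the set of its neighbours outside it, a clique adjacent to [x].
    A vertex of [C] that is simplicial in [C :|: S] is simplicial in [A]. To
    find one, apply the induction to [C :|: S] and a vertex [c] of it that is
    not adjacent to all others, taken in [S] if possible: the vertex obtained
    is then outside [S]. *)
Lemma simplicial_vertex_avoiding A x z :
    x \in A -> z \in A -> non_edge G x z ->
  exists y, [/\ y \in A, non_edge G x y & simplicial A y].
Proof.
have [n] := ubnP #|A|; elim: n A x z => // n IHn A x z /ltnSE le_An xA zA nxz.
pose B := [set w in A | non_edge G x w].
pose C := [set w | connect [rel u v in B | G u v] z w].
pose S := [set s in A | (s \notin C) && [exists c in C, G s c]].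
have zB : z \in B by rewrite inE zA.
have CB c : c \in C -> c \in B.
  rewrite inE => /connectP[p]; rewrite path_in // => /andP[_ /allP Bp] ->.
  by have := mem_last z p; rewrite in_cons => /predU1P[->|/Bp].
have zC : z \in C by rewrite inE connect0.
have xC c : c \in C -> c != x /\ ~~ G x c.
  by move=> /CB; rewrite inE eq_sym => /and3P[].
have Sx s : s \in S -> G x s.
  rewrite !inE => /and3P[sA sC /exists_inP[c cC Gsc]].
  apply: contraNT sC => nGxs; have cB := CB c cC.
  have xs : x != s.
    by apply: contraTneq Gsc => <-; case: (xC c cC).
  move: (cC); rewrite !inE => czc; apply: connect_trans czc (connect1 _).
  by rewrite /= cB inE sA /non_edge xs nGxs (edge_sym G).
have CA c : c \in C -> c \in A by move/CB; rewrite inE => /andP[].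
have SA s : s \in S -> s \in A by rewrite inE => /andP[].
have cliqueS : clique G S.
  move=> s t Ss St st; apply: (@separator_adjacent C s t x); rewrite ?Sx //.
  pose D := s |: (t |: C).
  have [c cC Gsc] : exists2 c, c \in C & G s c.
    by move: Ss; rewrite inE => /and3P[_ _ /exists_inP].
  have [d dC Gtd] : exists2 c, c \in C & G t c.
    by move: St; rewrite inE => /and3P[_ _ /exists_inP].
  have zD a : a \in C -> connect [rel u v in D | G u v] z a.
    rewrite inE => /connectP[p Bp ->]; apply/connectP; exists p => //.
    have DC b : b \in C -> b \in D by rewrite !inE => ->; rewrite !orbT.
    move: (Bp); rewrite !path_in ?DC // => /andP[-> _].
    apply/allP=> b pb; apply: DC; rewrite inE.
    by apply: (path_connect Bp); rewrite in_cons pb orbT.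
  have step u v : u \in D -> v \in D -> G u v ->
      connect [rel u v in D | G u v] u v.
    by move=> uD vD Guv; apply: connect1; rewrite /= uD vD.
  have [sD tD] : s \in D /\ t \in D by rewrite !inE !eqxx orbT.
  have [cD dD] : c \in D /\ d \in D by rewrite !in_setU cC dC !orbT.
  apply: connect_trans (step s c sD cD Gsc) _.
  apply: (@connect_trans _ _ z); first by rewrite connect_in_sym zD.
  by apply: connect_trans (zD d dC) _; rewrite connect_in_sym step.
pose A' := C :|: S.
have A'A a : a \in A' -> a \in A by rewrite inE => /orP[/CA|/SA].
have lt_A' : #|A'| < n.
  apply: leq_trans le_An; apply: proper_card; apply/properP; split.
    by apply/subsetP=> a /A'A.
  exists x => //; rewrite inE negb_or; apply/andP; split.
    by apply/negP=> /xC[]; rewrite eqxx.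
  by apply/negP=> /Sx; rewrite edge_irr.
suff [y [yC sy]] : exists y, y \in C /\ simplicial A' y.
  have yB := CB y yC; move: yB; rewrite inE => /andP[yA nxy].
  exists y; split=> // u v; rewrite !inE => /andP[uA yu] /andP[vA yv].
  have nbr w : w \in A -> G y w -> w \in [set z in A' | G y z].
    move=> wA yw; rewrite inE yw andbT in_setU.
    case: (boolP (w \in C)) => //= wC; rewrite inE wA wC /=.
    by apply/exists_inP; exists y; rewrite // (edge_sym G).
  by apply: sy; apply: nbr.
have step c d : c \in A' -> d \in A' -> non_edge G c d ->
    {in S, forall s, s != c -> G c s} -> exists y, y \in C /\ simplicial A' y.
  move=> cA dA ncd cS; case: (IHn A' c d lt_A' cA dA ncd) => y [yA ncy sy].
  exists y; split=> //; move: yA; rewrite inE => /orP[//|/cS].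
  by case/andP: ncy; rewrite eq_sym => -> /negPf -> /(_ isT).
case: (boolP [exists c in S, [exists d in A', non_edge G c d]]).
  case/exists_inP=> c cS /exists_inP[d dA ncd]; apply: (step c d) => //.
    by rewrite inE cS orbT.
  by move=> s sS sc; apply: cliqueS; rewrite // eq_sym.
move=> nS; case: (boolP [exists c in A', [exists d in A', non_edge G c d]]).
  case/exists_inP=> c cA /exists_inP[d dA ncd]; apply: (step c d) => //.
  move=> s sS sc; apply: contraNT nS => ncs.
  apply/exists_inP; exists s => //; apply/exists_inP; exists c => //.
  by rewrite /non_edge sc (edge_sym G).
move=> nA; exists z; split=> // u v; rewrite [u \in _]inE [v \in _]inE.
move=> /andP[uA _] /andP[vA _] uv.
apply: contraNT nA => nuv; apply/exists_inP; exists u => //.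
by apply/exists_inP; exists v; rewrite // /non_edge uv.
Qed.

Lemma simplicial_vertex A : A != set0 -> exists2 y, y \in A & simplicial A y.
Proof.
case/set0Pn=> a aA.
case: (boolP [exists c in A, [exists d in A, non_edge G c d]]).
  case/exists_inP=> c cA /exists_inP[d dA ncd].
  by case: (simplicial_vertex_avoiding cA dA ncd) => y []; exists y.
move=> nA; exists a => // u v; rewrite !inE => /andP[uA _] /andP[vA _] uv.
apply: contraNT nA => nuv; apply/exists_inP; exists u => //.
by apply/exists_inP; exists v; rewrite // /non_edge uv.
Qed.
End SimplicialVertex.

(** * Chordal graphs have tree representations *)

Section AddLeaf.
Variables (N : finType) (T : graph N) (t : N).

Definition leaf_edge : rel (option N) := fun x y =>
  match x, y with
  | Some a, Some b => T a b
  | Some a, None | None, Some a => a == t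
  | None, None => false
  end.

Lemma leaf_edge_sym : symmetric leaf_edge.
Proof. by case=> [a|] [b|] //=; rewrite (edge_sym T). Qed.

Lemma leaf_edge_irr : irreflexive leaf_edge.
Proof. by case=> [a|] //=; rewrite (edge_irr T). Qed.

Definition add_leaf : graph (option N) := Graph leaf_edge_sym leaf_edge_irr.

Lemma add_leaf_tree : tree T -> tree add_leaf.
Proof.
move=> treeT; have conT : forall u v, connect T u v.
  by apply: connected_connect; case: treeT.
split.
  apply: (@connect_connected _ _ (Some t)) => -[a|]; last exact/connect1/eqxx.
  apply: connect_map (conT t a) => x y Txy; exact: connect1.
move=> s ge3 /andP[cyc Us].
(* In a cycle, both neighbours of the leaf would have to be [Some t]. *)
have Ns : None \notin s.
  apply/negP=> /rot_to[i s' rot_s].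
  move: ge3 cyc Us; rewrite -(size_rot i) -(rot_cycle i) -(rot_uniq i) rot_s.
  case: s' {rot_s} => [|a [|b s']] // _; rewrite (cycle_path None).
  rewrite [last _ _]/= => /and3P[lN Na _] /and3P[Ns aN _].
  have lb := mem_last b s'; move: Na lN aN Ns lb.
  case: a => [a|] //= /eqP->; case: (last b s') => [c|] //= /eqP->.
  by move=> tN _ tb; rewrite tb in tN.
have [s0 s0E] : exists s0, s = map Some s0.
  elim: s Ns {ge3 cyc Us} => [|[a|] s IHs]; [by exists [::] | | by []].
  by rewrite inE /= => /IHs[s0 ->]; exists (a :: s0).
case: treeT => _ /(_ s0)[]; first by rewrite s0E size_map in ge3.
move: cyc Us; rewrite s0E map_inj_uniq; last exact: Some_inj.
rewrite /ucycle => + ->; rewrite andbT; case: s0 {s0E} => //= a s0.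
by rewrite -map_rcons path_map.
Qed.
End AddLeaf.

(** The partial representations built along an elimination ordering, [A] being
    the set of vertices already inserted. That every clique lies in some bag
    makes room for the next simplicial vertex, and gives the edges of the
    represented graph as a special case. *)
Definition clique_tree (V N : finType) (G : graph V) (T : graph N)
    (b : N -> {set V}) (A : {set V}) : Prop :=
  [/\ tree T, forall t, b t \subset A /\ clique G (b t),
      {in A, forall v, connected_set T (fiber b v)} &
      forall K : {set V}, K \subset A -> clique G K -> exists t, K \subset b t].

Lemma clique_tree_set0 (V : finType) (G : graph V) :
  exists (N : finType) (T : graph N) (b : N -> {set V}),
    clique_tree G T b set0.
Proof.
have sym : symmetric (fun _ _ : unit => false) by [].
have irr : irreflexive (fun _ _ : unit => false) by [].
exists unit, (Graph sym irr), (fun _ => set0); split.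
- split; first by apply: (@connect_connected _ _ tt) => -[].
  by case=> [|[] [|[] s]] //= _ /andP[_].
- by move=> _; split=> [|u v]; rewrite ?subxx ?inE.
- by move=> v; rewrite inE.
by move=> K K0 _; exists tt.
Qed.

(** Attach to a node whose bag contains the neighbours of [y] in [A] a leaf
    with bag [y] together with these neighbours. *)
Lemma clique_tree_add (V N : finType) (G : graph V) (T : graph N)
    (b : N -> {set V}) (A : {set V}) y :
    clique_tree G T b (A :\ y) -> y \in A -> simplicial G A y ->
  exists (N' : finType) (T' : graph N') (b' : N' -> {set V}),
    clique_tree G T' b' A.
Proof.
case=> treeT bA conb allK yA sy; set Ny := [set z in A | G y z] in sy.
have NyA : Ny \subset A :\ y.
  apply/subsetP=> z; rewrite !inE => /andP[-> yz]; rewrite andbT.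
  by apply: contraTneq yz => ->; rewrite edge_irr.
case: (allK Ny NyA sy) => t Nyt.
pose b' (x : option N) := if x is Some a then b a else y |: Ny.
have yb a : y \notin b a.
  by apply/negP=> /(subsetP (proj1 (bA a))); rewrite !inE eqxx.
exists (option N), (add_leaf T t), b'; split.
- exact: add_leaf_tree.
- case=> [a|] /=.
    case: (bA a) => /subset_trans sA cl; split=> //; apply: sA; exact: subD1set.
  split.
    by rewrite subUset sub1set yA (subset_trans NyA) // subD1set.
  move=> u v; rewrite !in_setU1 => /predU1P[->|uN] /predU1P[->|vN] uv.
  + by rewrite eqxx in uv.
  + by move: vN; rewrite inE => /andP[].
  + by move: uN; rewrite inE (edge_sym G) => /andP[].
  + exact: sy.
- move=> v vA; have [->|vy] := eqVneq v y.
    apply: (@connected_set_hub _ _ _ None); first by rewrite !inE eqxx.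
    case=> [a|]; rewrite inE /=; first by move/(negP (yb a)).
    by rewrite connect0.
  have vA' : v \in A :\ y by rewrite !inE vy.
  case: (conb v vA') => /set0Pn[a0 va0] conv.
  have lift a1 a2 : a1 \in fiber b v -> a2 \in fiber b v ->
     connect [rel x y in fiber b' v | add_leaf T t x y] (Some a1) (Some a2).
    move=> va1 va2; apply: connect_map (conv a1 a2 va1 va2) => x z /=.
    rewrite !inE => /andP[/andP[vx vz] Txz].
    by apply: connect1; rewrite /= !inE /= vx vz.
  apply: (@connected_set_hub _ _ _ (Some a0)); first by move: va0; rewrite !inE.
  case=> [a|]; rewrite inE /=.
    by move=> va; apply: (lift _ _ va0); rewrite inE.
  rewrite in_setU1 (negPf vy) /= => vN.
  have vt : t \in fiber b v by rewrite inE (subsetP Nyt).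
  apply: connect_trans (lift _ _ va0 vt) (connect1 _).
  have Nv : None \in fiber b' v by rewrite inE /= in_setU1 vN orbT.
  have tv : Some t \in fiber b' v by move: vt; rewrite !inE.
  by apply/andP; split; [apply/andP | exact/eqxx].
move=> K KA cK; have [yK|yK] := boolP (y \in K).
  exists None; apply/subsetP=> z zK; rewrite /= in_setU1.
  have [//|zy] := eqVneq z y; rewrite inE (subsetP KA) //=.
  by apply: cK; rewrite // eq_sym.
case: (allK K) => // [|a Ka]; last by exists (Some a).
by rewrite subsetD1 KA yK.
Qed.

Lemma chordal_representation_exists (V : finType) (H : graph V) : chordal H ->
  exists (N : finType) (T : graph N) (b : N -> {set V}),
    chordal_representation H T b.
Proof.
move=> chH.
suff [N [T [b [treeT bA conb allK]]]] : exists (N : finType) (T : graph N)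
    (b : N -> {set V}), clique_tree H T b [set: V].
  exists N, T, b; split=> // [v|]; first exact: conb.
  split=> [v|u v uv]; first by case: (conb v (in_setT v)).
  apply/idP/set0Pn=> [Huv|[t]]; last first.
    by rewrite !inE => /andP[ut vt]; case: (bA t) => _; apply.
  have [t] : exists t, [set u; v] \subset b t.
    apply: allK; rewrite ?subsetT // => x z.
    rewrite !inE => /orP[]/eqP-> /orP[]/eqP->; rewrite ?eqxx //.
    by rewrite (edge_sym H).
  by rewrite subUset !sub1set => /andP[ut vt]; exists t; rewrite !inE ut vt.
have [n] := ubnP #|[set: V]|; elim: n [set: V] => // n IHn A /ltnSE le_An.
have [->|A0] := eqVneq A set0; first exact: clique_tree_set0.
case: (simplicial_vertex chH A0) => y yA sy.
case: (IHn (A :\ y)) => [|N [T [b ct]]]; last exact: clique_tree_add ct yA sy.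
by rewrite (cardsD1 y) yA in le_An.
Qed.

(** * Comparing minima *)

Lemma least_pos_exists (P : nat -> Prop) k : 0 < k -> P k ->
  exists2 j, j <= k & least_pos P j.
Proof.
have [n] := ubnP k; elim: n k => // n IHn k /ltnSE le_kn k_gt0 Pk.
have [[j [lt_jk j_gt0 Pj]]|nP] :=
  classic (exists j, [/\ j < k, 0 < j & P j]).
  case: (IHn j (leq_trans lt_jk le_kn) j_gt0 Pj) => i le_ij li.
  by exists i => //; apply: leq_trans le_ij (ltnW lt_jk).
exists k => //; split=> // j j_gt0 Pj; rewrite leqNgt; apply/negP=> lt_jk.
by case: nP; exists j.
Qed.

(** The minima of [P] and [Q] agree even if a witness for one property gives a
    witness for the other only at a smaller value. *)
Lemma least_pos_transfer (P Q : nat -> Prop) k :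
    (forall j, 0 < j -> P j -> exists i, [/\ 0 < i, i <= j & Q i]) ->
    (forall j, 0 < j -> Q j -> exists i, [/\ 0 < i, i <= j & P i]) ->
  least_pos P k -> least_pos Q k.
Proof.
move=> PQ QP [k_gt0 Pk min_k].
have minQ j : 0 < j -> Q j -> k <= j.
  move=> j_gt0 /(QP j j_gt0)[i [i_gt0 le_ij Pi]].
  exact: leq_trans (min_k i i_gt0 Pi) le_ij.
case: (PQ k k_gt0 Pk) => i [i_gt0 le_ik Qi].
have eq_ik : i = k by apply/eqP; rewrite eqn_leq le_ik minQ.
by split; rewrite -?eq_ik // eq_ik.
Qed.

(** * The characterizations *)

Section Characterizations.
Variables (V : finType) (G : graph V).

(** What remains of [k] tree-decompositions once the chordal completions are
    forgotten, and of a family of convex sets in a product of [k] trees once it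
    is reduced to its projections. *)
Definition subtree_model (k : nat) : Prop :=
  exists (N : 'I_k -> finType) (T : forall i, graph (N i))
    (F : forall i, V -> {set N i}),
  [/\ forall i, tree (T i), forall i v, connected_set (T i) (F i v) &
      forall u v, u != v -> G u v = [forall i, F i u :&: F i v != set0]].

Definition separating_decompositions (k : nat) : Prop :=
  exists D : 'I_k -> tree_decomposition G, non_edge_separating D.

(** The injections into the common universe pull the chordal graphs back to
    induced subgraphs on [V], which are again chordal and contain [G]. *)
Lemma decompositions_of_chordal k :
  (exists (W : 'I_k -> finType) (H : forall i, graph (W i)),
    (forall i, chordal (H i)) /\ intersection_of G H) ->
  separating_decompositions k.
Proof.
case=> W [H [chH [X [f [g [inj_f inj_g VE GE]]]]]].
have /fin_all_exists[h hE] i : exists h : V -> W i, forall v, f i (h v) = g v.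
  have: forall v, exists w, f i w = g v by move=> v; apply: (VE _).1; exists v.
  by case/fin_all_exists=> h hE; exists h.
have inj_h i : injective (h i).
  by move=> u v /(congr1 (f i)); rewrite !hE; exact: inj_g.
pose e i : rel V := fun u v => H i (h i u) (h i v).
have e_sym i : symmetric (e i) by move=> u v; rewrite /e (edge_sym (H i)).
have e_irr i : irreflexive (e i) by move=> u; rewrite /e (edge_irr (H i)).
pose K i := Graph (e_sym i) (e_irr i).
have chK i : chordal (K i).
  move=> s [ge4 /andP[cyc Us] chordless]; apply: (chH i (map (h i) s)); split.
  - by rewrite size_map.
  - rewrite /ucycle (map_inj_uniq (@inj_h i)) Us andbT.
    by case: s cyc {ge4 Us chordless} => //= a s; rewrite -map_rcons path_map.
  move=> _ _ /mapP[x sx ->] /mapP[z sz ->] Kxz.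
  rewrite !(next_map (@inj_h i)) //.
  by case: (chordless x z sx sz Kxz); [left|right]; congr (h i _).
have GK u v : G u v <-> forall i, K i u v.
  apply: iff_trans (GE u v) _; split=> H' i.
    case: (H' i) => x [z [xu zv Hxz]].
    move: xu zv Hxz; rewrite -!(hE i) => xu zv.
    by rewrite (inj_f i _ _ xu) (inj_f i _ _ zv).
  by exists (h i u), (h i v); split; rewrite ?hE //; exact: H'.
have /fin_all_exists[D DE] i : exists D : tree_decomposition G,
    td_completion D = K i.
  case: (chordal_representation_exists (chK i)) => N [T [b rep]].
  have comp : chordal_completion G (K i) by split=> // u v /GK.
  by exists (TreeDecomposition comp rep).
exists D => u v /andP[uv nuv].
case: (boolP [exists i, ~~ K i u v]) => [/existsP[i nK]|].
  by exists i; rewrite /separates DE /non_edge uv.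
rewrite negb_exists => /forallP allK; case/negP: nuv; apply/GK=> i.
by have := allK i; rewrite negbK.
Qed.

Lemma chordal_of_decompositions k : 0 < k -> separating_decompositions k ->
  exists (W : 'I_k -> finType) (H : forall i, graph (W i)),
    (forall i, chordal (H i)) /\ intersection_of G H.
Proof.
move=> k_gt0 [D sepD]; exists (fun=> V), (fun i => td_completion (D i)).
split=> [i|]; first by case: (td_completionP (D i)).
exists V, (fun _ v => v), id; split=> [i|||u v]; try exact: inj_id.
  by move=> z; split=> [_ i|_]; exists z.
split=> [Guv i|allD].
  by exists u, v; split=> //; case: (td_completionP (D i)) => _; apply.
have {}allD i : td_completion (D i) u v by case: (allD i) => x [y [-> ->]].
apply: contraT => nG; have uv : u != v.
  by apply: contraTneq (allD (Ordinal k_gt0)) => ->; rewrite edge_irr.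
have /sepD[i] : non_edge G u v by rewrite /non_edge uv.
by rewrite /separates /non_edge allD andbF.
Qed.

Lemma subtree_model_of_decompositions k :
  separating_decompositions k -> subtree_model k.
Proof.
case=> D sepD; exists (fun i => td_node (D i)), (fun i => td_tree (D i)).
exists (fun i => fiber (@td_bag _ _ (D i))); split=> [i|i v|u v uv].
- by case: (td_representation (D i)).
- by case: (td_representation (D i)).
have DE i : td_completion (D i) u v =
    (fiber (@td_bag _ _ (D i)) u :&: fiber (@td_bag _ _ (D i)) v != set0).
  by case: (td_representation (D i)) => _ _ _ [_]; apply.
apply/idP/forallP=> [Guv i|meet].
  by rewrite -DE; case: (td_completionP (D i)) => _; apply.
apply: contraT => nG; have /sepD[i] : non_edge G u v by rewrite /non_edge uv.
by rewrite /separates /non_edge DE meet andbF.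
Qed.

Lemma decompositions_of_subtree_model k :
  subtree_model k -> separating_decompositions k.
Proof.
case=> N [T [F [treeT conF GE]]].
pose e i : rel V := fun u v => (u != v) && (F i u :&: F i v != set0).
have e_sym i : symmetric (e i) by move=> u v; rewrite /e eq_sym setIC.
have e_irr i : irreflexive (e i) by move=> u; rewrite /e eqxx.
pose H i := Graph (e_sym i) (e_irr i).
have HE i u v : u != v -> H i u v = (F i u :&: F i v != set0).
  by move=> uv; rewrite /= /e uv.
have chH i : chordal (H i).
  exact: (subtree_graph_chordal (treeT i) (conF i) (HE i)).
have GH i : subrel G (H i).
  move=> u v Guv; have uv : u != v.
    by apply: contraTneq Guv => ->; rewrite edge_irr.
  by move: Guv; rewrite GE // => /forallP/(_ i); rewrite HE.
pose b i (t : N i) := [set v | t \in F i v].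
have fibE i v : fiber (b i) v = F i v by apply/setP=> t; rewrite !inE.
have rep i : chordal_representation (H i) (T i) (b i).
  split=> // [v|]; first by rewrite fibE.
  split=> [v|u v uv]; first by rewrite fibE; case: (conF i v).
  by rewrite !fibE HE.
exists (fun i => TreeDecomposition (conj (chH i) (@GH i)) (rep i)).
move=> u v /andP[uv]; rewrite GE // negb_forall => /existsP[i nF].
by exists i; rewrite /separates /non_edge uv /= /e uv nF.
Qed.

Lemma tree_product_of_subtree_model k :
  subtree_model k -> tree_product_intersection G k.
Proof.
case=> N [T [F [treeT conF GE]]]; exists N, T; split=> //.
pose B v := [set x : {dffun forall i, N i} | [forall i, x i \in F i v]].
exists B; split=> [v|].
  apply: (box_convex (trees_connect treeT)) => i.
  exact: tree_connected_convex.
split=> [v|u v uv].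
  have /fin_all_exists[x xF] : forall i, exists t, t \in F i v.
    by move=> i; case: (conF i v) => /set0Pn.
  apply/set0Pn; exists [ffun i => x i]; rewrite inE; apply/forallP=> i.
  by rewrite ffunE.
rewrite GE //; apply/forallP/set0Pn=> [meet|[x]].
  have /fin_all_exists[x xF] : forall i, exists t, t \in F i u :&: F i v.
    by move=> i; apply/set0Pn.
  exists [ffun i => x i]; rewrite !inE.
  by apply/andP; split; apply/forallP=> i; have := xF i;
    rewrite ffunE inE => /andP[].
rewrite !inE => /andP[/forallP ux /forallP vx] i.
by apply/set0Pn; exists (x i); rewrite inE ux vx.
Qed.

(** Replace each convex set by its projections to the trees. If two convex
    sets [F u] and [F v] are disjoint, take [x] in the first and [y] in the
    second as close as possible: by the gate property [x] is between any point
    [w] of [F u] and [y], and [y] is between [x] and any point [z] of [F v]. In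
    a tree where [x] and [y] have distinct projections, this betweenness
    persists and forbids [w] and [z] to have a common one. *)
Lemma subtree_model_of_median k (X : finType) (M : graph X)
    (N : 'I_k -> finType) (T : forall i, graph (N i))
    (f : X -> {dffun forall i, N i}) (F : V -> {set X}) :
  median M -> (forall i, tree (T i)) -> isometric M (cartesian_product T) f ->
  (forall v, convex M (F v)) -> intersection_graph G F -> subtree_model k.
Proof.
move=> medM treeT iso cF [F0 GE].
have conM : forall u v, connect M u v by apply: connected_connect; case: medM.
have conT := trees_connect treeT.
have distf x y : dist M x y = \sum_i dist (T i) (f x i) (f y i).
  case: (iso x y) => _ -> //; by case: (prod_dist conT (f x) (f y)).
have between x y z i : z \in interval M x y ->
    dist (T i) (f x i) (f y i) =
      dist (T i) (f x i) (f z i) + dist (T i) (f z i) (f y i).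
  move=> /intervalP dz; apply/intervalP.
  suff: f z \in interval (cartesian_product T) (f x) (f y).
    by rewrite prod_interval // => /forallP.
  by apply/intervalP; rewrite -!(proj2 (iso _ _)).
pose P i v := [set f x i | x in F v].
exists N, T, P; split=> // [i v|u v uv].
  case: (convex_connected conM (F0 v) (cF v)) => /set0Pn[x0 vx0] conv.
  apply: (@connected_set_hub _ _ _ (f x0 i)); first exact: imset_f.
  move=> _ /imsetP[x vx ->].
  apply: (connect_map (h := fun x => f x i)) (conv _ _ vx0 vx).
  move=> y z /= /andP[/andP[vy vz] Myz].
  have := dist_edge Myz; rewrite distf (bigD1 i) //=.
  case: (dist_path (conT i (f y i) (f z i))) => p [Tp lp] <-.
  case: p Tp lp => [_ /= -> _|a [|b p]] //=.
  rewrite andbT => + az _; rewrite az => Ta; apply: connect1.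
  by rewrite /= Ta !(imset_f (fun x => f x i)).
rewrite GE //; apply/idP/forallP=> [/set0Pn[x] + i|meet].
  rewrite inE => /andP[ux vx]; apply/set0Pn; exists (f x i).
  by rewrite inE !imset_f.
apply: contraT; rewrite negbK => /eqP disj.
have [[x y] /= /andP[ux vy] min_xy] : exists2 p : X * X,
    (p.1 \in F u) && (p.2 \in F v) &
    forall q : X * X, (q.1 \in F u) && (q.2 \in F v) ->
      dist M p.1 p.2 <= dist M q.1 q.2.
  case/set0Pn: (F0 u) => x0 ux0; case/set0Pn: (F0 v) => y0 vy0.
  have P0 : ((x0, y0).1 \in F u) && ((x0, y0).2 \in F v) by rewrite /= ux0.
  case: (@arg_minnP _ (x0, y0) (fun q : X * X => (q.1 \in F u) && (q.2 \in F v))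
    (fun q => dist M q.1 q.2) P0) => p; by exists p.
have gate_x w : w \in F u -> x \in interval M w y.
  rewrite interval_sym //.
  apply: (gate conM (median_exists medM) (cF u) ux) => s us.
  by rewrite !(dist_sym conM y); apply: (min_xy (s, y)); rewrite /= us.
have gate_y w : w \in F v -> y \in interval M x w.
  apply: (gate conM (median_exists medM) (cF v) vy) => s vs.
  by apply: (min_xy (x, s)); rewrite /= ux.
have [i ni] : exists i, f x i != f y i.
  apply/existsP; apply: contraT; rewrite negb_exists => /forallP eq_f.
  have dxy : dist M x y = 0.
    by rewrite distf big1 // => i _; rewrite (eqP (negbNE (eq_f i))) distuu.
  have /setP/(_ x) := disj; rewrite !inE ux.
  by rewrite (dist0_eq conM dxy) vy.
case/set0Pn: (meet i) => t; rewrite inE.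
case/andP=> /imsetP[w uw tw] /imsetP[z vz tz].
have := between _ _ _ i (gate_x w uw); have := between _ _ _ i (gate_y z vz).
rewrite -tw -tz.
rewrite (dist_sym (@conT i) t (f x i)) (dist_sym (@conT i) t (f y i)) => dy dx.
by case/eqP: ni; apply: (dist0_eq (@conT i)); lia.
Qed.

Lemma subtree_model_of_tree_product k :
  tree_product_intersection G k -> subtree_model k.
Proof.
case=> N [T [treeT [F [cF GF]]]].
have medP := tree_product_median treeT.
by apply: (subtree_model_of_median medP treeT _ cF GF) => x y.
Qed.

Lemma subtree_model_of_property_M k : property_M k G -> subtree_model k.
Proof.
case=> X [M [F [medM [_ [N [T [treeT [f iso]]]] _] cF GF]]].
exact: (subtree_model_of_median medM treeT iso cF GF).
Qed.

(** The product of the [k] trees is itself the median graph; it embeds in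
    itself, so that its tree-dimension is at most [k]. *)
Lemma property_M_of_tree_product k : 0 < k -> tree_product_intersection G k ->
  exists j, [/\ 0 < j, j <= k & property_M j G].
Proof.
move=> k_gt0 [N [T [treeT [F [cF GF]]]]].
have [j le_jk lj] : exists2 j, j <= k &
    has_tree_dimension (cartesian_product T) j.
  apply: least_pos_exists => //.
  by exists N, T; split=> //; exists id.
exists j; split=> //; first by case: lj.
by exists _, (cartesian_product T), F; split=> //; exact: tree_product_median.
Qed.

(** Completeness means that two vertices with meeting fibers are adjacent in
    [G], which forces the represented supergraph to be [G] itself. *)
Lemma property_M_complete k : property_M k G <->
  exists (X : finType) (M : graph X) (c : X -> {set V}),
    tree_median_decomposition k G M c /\ complete_decomposition G c.
Proof.
split=> [[X [M [F [medM dimM cF GF]]]]|[X [M [c [[H tmd] complete]]]]].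
  pose c x := [set v | x \in F v].
  have fibE v : fiber c v = F v by apply/setP=> x; rewrite !inE.
  exists X, M, c; split.
    exists G; split=> //; first by exists X, M, F.
    split=> // [v|]; first by rewrite fibE.
    by case: GF => F0 GE; split=> [v|u v uv]; rewrite !fibE ?GE.
  move=> x u v; rewrite !inE => ux vx uv; case: GF => _ -> //.
  by apply/set0Pn; exists x; rewrite inE ux.
case: tmd => GH _ [medM dimM cc Hc].
exists X, M, (fiber c); split=> //; case: Hc => c0 HE; split=> // u v uv.
apply/idP/idP=> [/GH|/set0Pn[x]]; first by rewrite HE.
by rewrite !inE => /andP[ux vx]; apply: (complete x).
Qed.
End Characterizations.

Theorem theorem1p1 (V : finType) (G : graph V) (k : nat) (k_gt0 : 0 < k) :
  [<-> has_chordality G k;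
       least_pos (fun j => exists D : 'I_j -> tree_decomposition G,
                    non_edge_separating D) k;
       least_pos (fun j => tree_product_intersection G j) k;
       least_pos (fun j => property_M j G) k;
       has_tree_median_dimension G k].
Proof.
have pointwise (P Q : nat -> Prop) : (forall j, 0 < j -> P j <-> Q j) ->
    least_pos P k -> least_pos Q k.
  move=> PQ; apply: least_pos_transfer => j j_gt0 /(PQ j j_gt0);
    by exists j.
tfae.
- apply: pointwise => j j_gt0; split; first exact: decompositions_of_chordal.
  exact: chordal_of_decompositions.
- apply: pointwise => j _; split.
    by move/subtree_model_of_decompositions/tree_product_of_subtree_model.
  by move/subtree_model_of_tree_product/decompositions_of_subtree_model.
- apply: least_pos_transfer => j j_gt0; first exact: property_M_of_tree_product.
  move/subtree_model_of_property_M/tree_product_of_subtree_model.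
  by exists j.
- by apply: pointwise => j _; exact: property_M_complete.
apply: least_pos_transfer => j j_gt0.
  move/property_M_complete/subtree_model_of_property_M.
  move/decompositions_of_subtree_model/(chordal_of_decompositions j_gt0).
  by exists j.
move/decompositions_of_chordal/subtree_model_of_decompositions.
move/tree_product_of_subtree_model/(property_M_of_tree_product j_gt0).
by case=> i [i0 le_i /property_M_complete Mi]; exists i.
Qed.
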